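(* Let $d\ge 3$ be an integer, $L,\Delta>0$, $\mathbf{x}_0\in\mathbb{R}^d$, and $$0<\delta<\frac{\Delta}{L},\qquad 0<\epsilon<\frac{L}{3}.$$ For every integer $T\ge 1$ satisfying $$T+1\le\left(\frac{L-\epsilon}{2\epsilon}\right)^{(d-2)/2},$$ and every deterministic algorithm $A$ in the local-oracle model, there exists a fixed function $f\in\mathcal{F}_d(L,\Delta;\mathbf{x}_0)$ with $\tau_A(f;\mathbf{x}_0,\delta,\epsilon)>T$. Every point $\mathbf{q}$ actually queried by $A$ among the first $T$ calls (when run on $f$), and the output $\mathbf{q}$ if $A$ returns within $T$ calls, satisfies $$\operatorname{dist}(\mathbf{0},\partial_\delta f(\mathbf{q}))>\epsilon.$$ Moreover, $f(\mathbf{x}_0)=0$, $\inf f=-\Delta$, and $\operatorname{int}(\arg\min f)\neq\varnothing$.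
   Context: All norms are Euclidean; $\mathbb{B}_r(\mathbf{x})$ is the closed ball of radius $r$ about $\mathbf{x}$. Goldstein stationarity. For locally Lipschitz $f:\mathbb{R}^d\to\mathbb{R}$, $f^\circ(\mathbf{x};\mathbf{v})=\limsup_{\mathbf{y}\to\mathbf{x},\,t\downarrow 0}\frac{f(\mathbf{y}+t\mathbf{v})-f(\mathbf{y})}{t}$, the Clarke subdifferential is $\partial f(\mathbf{x})=\{\mathbf{g}:\langle\mathbf{g},\mathbf{v}\rangle\le f^\circ(\mathbf{x};\mathbf{v})\ \forall\mathbf{v}\in\mathbb{R}^d\}$, and the Goldstein subdifferential is $\partial_\delta f(\mathbf{x})=\mathrm{conv}\big(\bigcup_{\mathbf{y}\in\mathbb{B}_\delta(\mathbf{x})}\partial f(\mathbf{y})\big)$. A point $\mathbf{x}$ is $(\delta,\epsilon)$-Goldstein stationary if $\operatorname{dist}(\mathbf{0},\partial_\delta f(\mathbf{x}))=\inf_{\mathbf{g}\in\partial_\delta f(\mathbf{x})}\|\mathbf{g}\|\le\epsilon$. Function class. $\mathcal{F}_d(L,\Delta;\mathbf{x}_0)$ is the set of all $f:\mathbb{R}^d\to\mathbb{R}$ with $|f(\mathbf{x})-f(\mathbf{y})|\le L\|\mathbf{x}-\mathbf{y}\|$ for all $\mathbf{x},\mathbf{y}$, $\inf f>-\infty$, and $f(\mathbf{x}_0)-\inf f\le\Delta$. Local-oracle model. The algorithm receives $d,L,\Delta,\mathbf{x}_0,\delta,\epsilon$. Its first oracle call is at $\mathbf{x}_0$. An admissible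 oracle response to a query at $\mathbf{q}$ is any locally Lipschitz function $h_{\mathbf{q}}:\mathbb{R}^d\to\mathbb{R}$ such that $h_{\mathbf{q}}=f$ on $\mathbb{B}_{\nu}(\mathbf{q})$ for some $\nu=\nu_{\mathbf{q}}>0$; the radius is not revealed. A deterministic algorithm's internal computation, next query, stopping decision and output depend only on the input and on the local information in the previous responses, i.e. on the sequence of previous query points and the germs at these points of the returned functions: replacing any finite collection of responses by functions agreeing with them near the corresponding query points does not change the subsequent behavior before a new response is received. Thus, after each finite history, the algorithm either queries a new point of $\mathbb{R}^d$, returns a point of $\mathbb{R}^d$, or computes forever without any further query or return. Query locations are unrestricted, repeated queries are allowed, and the output need not have been queried. Arbitrary finite internal computation with exact real arithmetic and comparisons is allowed between calls. Every oracle call is counted, including the initial one and repeated ones. Query count. If the execution of $A$ on $f$ returns, in finite time, a $(\delta,\epsilon)$-Goldstein stationary point of $f$, then $\tau_A(f;\mathbf{x}_0,\delta,\epsilon)$ is its total number of oracle calls; if it never returns or returns a point that is not $(\delta,\epsilon)$-Goldstein stationary, then $\tau_A(f;\mathbf{x}_0,\delta,\epsilon)=+\infty$. *)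

(* Defs.v *)
From HB Require Import structures.
From mathcomp Require Import all_boot all_order all_algebra.
From mathcomp Require Import all_classical all_reals all_analysis.

Set Implicit Arguments.
Unset Strict Implicit.
Unset Printing Implicit Defensive.

Import Order.TTheory GRing.Theory Num.Theory.
Import numFieldNormedType.Exports.

Local Open Scope classical_set_scope.
Local Open Scope ring_scope.

Section Goldstein.
Context {R : realType} {d : nat}.
Implicit Types (f : 'rV[R]_d -> R) (x v g : 'rV[R]_d).

Definition dotv x v : R := \sum_(i < d) x 0 i * v 0 i.

(* The norm `|x| provided by the library on 'rV_d is the maximum norm; it
   induces the same topology as enorm, but a different metric. *)
Definition enorm x : R := Num.sqrt (dotv x x).

Definition eball (r : R) x : set 'rV[R]_d := [set y | enorm (y - x) <= r].

Definition lipschitz_within (K : R) (A : set 'rV[R]_d) f : Prop :=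
  forall x y, A x -> A y -> `|f x - f y| <= K * enorm (x - y).

Definition locally_lipschitz f : Prop :=
  forall x, exists r K : R, 0 < r /\ lipschitz_within K (eball r x) f.

(* The limsup is over pairs (y, t) with y -> x (y = x allowed) and t -> 0+;
   it is taken in \bar R, and is finite when f is locally Lipschitz. *)
Definition clarke_dderiv f x v : \bar R :=
  limf_esup (fun yt : 'rV[R]_d * R =>
               ((f (yt.1 + yt.2 *: v) - f yt.1) / yt.2)%:E)
            (filter_prod (nbhs x) (0 : R)^'+).

Definition clarke_subdiff f x : set 'rV[R]_d :=
  [set g | forall v, ((dotv g v)%:E <= clarke_dderiv f x v)%E].

Definition conv_hull (S : set 'rV[R]_d) : set 'rV[R]_d :=
  smallest (@convex_set R 'rV[R]_d) S.

Definition goldstein_subdiff (delta : R) f x : set 'rV[R]_d :=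
  conv_hull (\bigcup_(y in eball delta x) clarke_subdiff f y).

(* dist(0, S), with the infimum in \bar R. *)
Definition dist0 (S : set 'rV[R]_d) : \bar R :=
  ereal_inf [set (enorm g)%:E | g in S].

Definition goldstein_stationary (delta eps : R) f x : Prop :=
  (dist0 (goldstein_subdiff delta f x) <= eps%:E)%E.

Definition lipschitz_class (L Delta : R) (x0 : 'rV[R]_d) : set ('rV[R]_d -> R) :=
  [set f | [/\ lipschitz_within L setT f,
               has_lbound (range f)
             & f x0 - inf (range f) <= Delta]].

Definition argmin f : set 'rV[R]_d := [set x | forall y, f x <= f y].

End Goldstein.

Record response (R : realType) (d : nat) := Response {
  response_fun :> 'rV[R]_d -> R;
  response_lip : locally_lipschitz response_fun }.

(* Past oracle calls, oldest first: query points with the functions returned. *)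
Definition history (R : realType) (d : nat) := seq ('rV[R]_d * response R d).

Variant action (R : realType) (d : nat) :=
  | Query of 'rV[R]_d
  | Return of 'rV[R]_d
  | Diverge.

Arguments Diverge {R d}.

Definition strategy (R : realType) (d : nat) := history R d -> action R d.

Fixpoint same_local_info {R : realType} {d : nat} (h h' : history R d) : Prop :=
  match h, h' with
  | [::], [::] => True
  | c :: h1, c' :: h1' =>
      [/\ c.1 = c'.1, \forall y \near c.1, c.2 y = c'.2 y
        & same_local_info h1 h1']
  | _, _ => False
  end.

(* A deterministic algorithm is identified with the map sending its input
   (d, L, Delta, x0, delta, eps) and a finite history to what it does next;
   internal computation is not restricted beyond its reading the responses
   only through their germs. *)
Record algorithm (R : realType) := Algorithm {
  algorithm_step :> forall (d : nat) (L Delta : R) (x0 : 'rV[R]_d)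
                      (delta eps : R), strategy R d;
  algorithm_start : forall d L Delta (x0 : 'rV[R]_d) delta eps,
    algorithm_step L Delta x0 delta eps [::] = Query x0;
  algorithm_local : forall d L Delta (x0 : 'rV[R]_d) delta eps h h',
    same_local_info h h' ->
    algorithm_step L Delta x0 delta eps h =
    algorithm_step L Delta x0 delta eps h' }.

Section Execution.
Context {R : realType} {d : nat}.
Implicit Types (s : strategy R d) (f : 'rV[R]_d -> R) (x q : 'rV[R]_d).

(* O k q is the response to a query at q made as call number k (from 0), so
   repeated queries of the same point may receive different responses. *)
Definition oracle := nat -> 'rV[R]_d -> response R d.

Definition admissible f (O : oracle) : Prop :=
  forall k q, exists2 nu : R, 0 < nu & forall y, eball nu q y -> O k q y = f y.

(* The history after n calls; None if fewer than n calls are made. *)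
Fixpoint transcript s (O : oracle) (n : nat) : option (history R d) :=
  if n is k.+1 then
    if transcript s O k is Some h then
      if s h is Query q then Some (rcons h (q, O k q)) else None
    else None
  else Some [::].

Definition queries s (O : oracle) (k : nat) q : Prop :=
  exists2 h, transcript s O k = Some h & s h = Query q.

Definition returns s (O : oracle) (n : nat) x : Prop :=
  exists2 h, transcript s O n = Some h & s h = Return x.

(* At most one n belongs to the set below, since s acts deterministically; the
   infimum is +oo when the set is empty, i.e. when the run does not return a
   (delta, eps)-Goldstein stationary point of f. *)
Definition query_count s (O : oracle) f (delta eps : R) : \bar R :=
  ereal_inf [set (n%:R : R)%:E | n in
    [set n | exists2 x, returns s O n x & goldstein_stationary delta eps f x]].

End Execution.

Arguments oracle R d : clear implicits.

(* Main.v *)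
Require Import Defs.
From mathcomp Require Import all_boot all_order all_algebra.
From mathcomp Require Import all_classical all_reals all_analysis.
From mathcomp Require Import ring lra.

Import Order.TTheory GRing.Theory Num.Theory.
Import numFieldNormedType.Exports.

Local Open Scope classical_set_scope.
Local Open Scope ring_scope.

(** A resisting-oracle argument.  Every query, wherever it is made, can be
    answered by the same germ, the affine function [- kappa * (x - q)_0] with
    value [0] at the query [q].  These answers fix the whole run of the
    algorithm in advance: its [T] queries and its possible output form a set
    [pts] of at most [T + 1] points.  Only then is a unit vector [v] chosen,
    and a function [f] that agrees with all the answers and decreases along [v]
    at a rate [e > eps] everywhere near [pts].

    For fixed [v], let [g z = c |z - <z, v> v| - e <z, v>] with [c + e = L]
    ([cone_gauge]).  It is [L]-Lipschitz, decreases along [v] at rate exactly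
    [e], and is positive outside a cone about [v] of aperture about [e / c].
    The function [max (- kappa (x - q)_0, g (x - q) - eta)] ([bump]) shares the
    first two properties if [kappa v_0 = e] and [kappa <= L], and is the prescribed germ near
    [q].  If [g (p - q) > eta] for all distinct [p], [q] in [pts], then the
    minimum [G] of these functions over [q] in [pts] still has the prescribed
    germ at each point of [pts] ([lower_envelope_near]).

    Put [f = max (- Delta, G)].  As [G] is unbounded below along [v], the
    infimum of [f] is [- Delta], and it is attained on an open set.  As [G = 0]
    on [pts] and [L * delta < Delta], the truncation is inactive on the ball of
    radius [delta] about a point of [pts]; there all Clarke subgradients satisfy
    [<g, v> <= - e], a property that passes to convex hulls and gives
    [|g| >= e > eps] ([dist0_goldstein_truncation]).

    It remains to find [v] such that no difference of two points of [pts] lies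
    in the cone of [v].  With [v = (3/5, (4/5) sqrt (1 - |p|^2), (4/5) p)], each
    difference excludes from the unit ball of dimension [d - 2], where [p]
    ranges, only a ball of radius [r = (5/4) (e / c)]
    ([exists_hidden_direction]).  There are at most [(T + 1)^2] differences, and
    the bound on [T] says that [(T + 1)^2 r^(d - 2) < 1]
    ([pairs_times_ball_lt1]), so these balls do not cover the unit ball
    ([exists_uncovered_point]). *)

(** * Euclidean norm *)

Section Euclidean.
Context {R : realType} {d : nat}.
Implicit Types x y z v : 'rV[R]_d.

Lemma dotvC x y : dotv x y = dotv y x.
Proof. by apply: eq_bigr => i _; rewrite mulrC. Qed.

Lemma dotvDl x y z : dotv (x + y) z = dotv x z + dotv y z.
Proof. by rewrite -big_split; apply: eq_bigr => i _; rewrite mxE mulrDl. Qed.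

Lemma dotvZl (a : R) x y : dotv (a *: x) y = a * dotv x y.
Proof. by rewrite big_distrr; apply: eq_bigr => i _; rewrite mxE -mulrA. Qed.

Lemma dotvNl x y : dotv (- x) y = - dotv x y.
Proof. by rewrite -scaleN1r dotvZl mulN1r. Qed.

Lemma dotvDr x y z : dotv x (y + z) = dotv x y + dotv x z.
Proof. by rewrite dotvC dotvDl !(dotvC x). Qed.

Lemma dotvZr (a : R) x y : dotv x (a *: y) = a * dotv x y.
Proof. by rewrite dotvC dotvZl dotvC. Qed.

Lemma dotvNr x y : dotv x (- y) = - dotv x y.
Proof. by rewrite dotvC dotvNl dotvC. Qed.

Definition dotvE := (dotvDl, dotvDr, dotvNl, dotvNr, dotvZl, dotvZr).

Lemma dotv_ge0 x : 0 <= dotv x x.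
Proof. by apply: sumr_ge0 => i _; rewrite -expr2 sqr_ge0. Qed.

Lemma enorm_ge0 x : 0 <= enorm x.
Proof. exact: sqrtr_ge0. Qed.

Lemma sqr_enorm x : enorm x ^+ 2 = dotv x x.
Proof. by rewrite sqr_sqrtr // dotv_ge0. Qed.

Lemma enorm0 : enorm (0 : 'rV[R]_d) = 0.
Proof. by rewrite /enorm -(scale0r 0) dotvZl mul0r sqrtr0. Qed.

Lemma enormZ (a : R) x : enorm (a *: x) = `|a| * enorm x.
Proof.
by rewrite /enorm dotvZl dotvZr mulrA -expr2 sqrtrM ?sqr_ge0// sqrtr_sqr.
Qed.

Lemma enormN x : enorm (- x) = enorm x.
Proof. by rewrite -scaleN1r enormZ normrN1 mul1r. Qed.

Lemma enormB x y : enorm (x - y) = enorm (y - x).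
Proof. by rewrite -enormN opprB. Qed.

Lemma le_coord_enorm x i : `|x 0 i| <= enorm x.
Proof.
rewrite -(@ler_pXn2r _ 2) ?nnegrE ?normr_ge0 ?enorm_ge0// sqr_enorm.
rewrite real_normK ?num_real// /dotv (bigD1 i)//= -expr2 lerDl.
by apply: sumr_ge0 => j _; rewrite -expr2 sqr_ge0.
Qed.

Lemma enorm_eq0 x : enorm x = 0 -> x = 0.
Proof.
move=> x0; apply/rowP => i; rewrite mxE; apply/eqP.
by rewrite -normr_le0 -x0 le_coord_enorm.
Qed.

Lemma enorm_gt0 x : x != 0 -> 0 < enorm x.
Proof.
by move=> xn0; rewrite lt_def enorm_ge0 andbT; apply: contraNneq xn0 => /enorm_eq0 ->.
Qed.

Lemma dotv_le_enorm x y : `|dotv x y| <= enorm x * enorm y.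
Proof.
have [->|yn0] := eqVneq y 0.
  by rewrite -(scale0r 0) dotvZr mul0r normr0 mulr_ge0 ?enorm_ge0.
rewrite -(@ler_pXn2r _ 2) ?nnegrE ?mulr_ge0 ?normr_ge0 ?enorm_ge0//.
rewrite exprMn !sqr_enorm real_normK ?num_real//.
have y0 : 0 < dotv y y by rewrite -sqr_enorm exprn_gt0 ?enorm_gt0.
(* the discriminant inequality, from the component of x orthogonal to y *)
have := dotv_ge0 (dotv y y *: x - dotv x y *: y).
rewrite !dotvE (dotvC y x) => h.
rewrite -(ler_pM2l y0); nra.
Qed.

Lemma enormD x y : enorm (x + y) <= enorm x + enorm y.
Proof.
rewrite -(@ler_pXn2r _ 2) ?nnegrE ?addr_ge0 ?enorm_ge0//.
rewrite sqr_enorm !dotvE (dotvC y x) sqrrD !sqr_enorm.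
have := le_trans (ler_norm _) (dotv_le_enorm x y); lra.
Qed.

Lemma enorm_lip x y : `|enorm x - enorm y| <= enorm (x - y).
Proof.
have h (a b : 'rV[R]_d) : enorm a - enorm b <= enorm (a - b).
  by have := enormD (a - b) b; rewrite subrK; lra.
by rewrite ler_norml; have := h x y; have := h y x; rewrite enormB; lra.
Qed.

Lemma enorm_le_mx_norm x : enorm x <= d%:R * `|x|.
Proof.
rewrite -(@ler_pXn2r _ 2) ?nnegrE ?mulr_ge0 ?ler0n ?normr_ge0 ?enorm_ge0//.
rewrite sqr_enorm exprMn.
apply: (@le_trans _ _ (\sum_(i < d) `|x| ^+ 2)).
  apply: ler_sum => i _; rewrite -expr2 -real_normK ?num_real//.
  by rewrite ler_pXn2r ?nnegrE// [leRHS]mx_normrE; apply: (le_bigmax _ _ (0, i)).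
rewrite sumr_const card_ord -[leLHS]mulr_natl ler_wpM2r ?sqr_ge0//.
by rewrite -natrX ler_nat; case: (d) => // k; rewrite expnS leq_pmulr.
Qed.

(** The maximum norm defines the topology of ['rV_d], while every estimate here
    is Euclidean; this is the bridge between the two. *)
Lemma near_eball x (r : R) (P : set 'rV[R]_d) :
  0 < r -> eball r x `<=` P -> \forall y \near x, P y.
Proof.
move=> r0 sub; apply/nbhs_ballP; exists (r / d.+1%:R) => /=.
  by rewrite divr_gt0.
move=> y; rewrite -ball_normE /= => xy; apply: sub; rewrite /eball /= enormB.
apply: (le_trans (enorm_le_mx_norm _)).
apply: (@le_trans _ _ (d%:R * (r / d.+1%:R))); first by rewrite ler_wpM2l// ltW.
by rewrite mulrCA ler_piMr ?(ltW r0)// ler_pdivrMr// mul1r ler_nat.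
Qed.

End Euclidean.

(** * Coverings of the unit ball by small balls *)

Section Covering.
Context {R : realType} {n : nat}.
Implicit Types (p c : 'rV[R]_n) (cs : seq 'rV[R]_n).

Definition covers_unit_ball (r : R) cs :=
  forall p, enorm p <= 1 -> exists2 c, c \in cs & enorm (p - c) <= r.

Lemma covers_unit_ball_exp (r : R) cs (k : nat) : 0 < r ->
  covers_unit_ball r cs ->
  exists2 cs', size cs' = (size cs ^ k)%N & covers_unit_ball (r ^+ k) cs'.
Proof.
move=> r0 cov; elim: k => [|k [cs' szs cov']].
  by exists [:: 0] => // p p1; exists 0; rewrite ?mem_head// subr0 expr0.
exists [seq c' + r ^+ k *: c | c <- cs, c' <- cs'].
  by rewrite size_allpairs szs expnS.
move=> p p1; have [c' c'in pc'] := cov' p p1.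
have rk : 0 < r ^+ k by rewrite exprn_gt0.
(* p - c' lies in a ball of radius r ^ k, a rescaled copy of the unit ball *)
have [|c cin pc] := cov ((r ^+ k)^-1 *: (p - c')).
  by rewrite enormZ ger0_norm ?invr_ge0 ?(ltW rk)// ler_pdivrMl// mulr1.
exists (c' + r ^+ k *: c); first by apply/allpairsP; exists (c, c').
have -> : p - (c' + r ^+ k *: c) = r ^+ k *: ((r ^+ k)^-1 *: (p - c') - c).
  by rewrite scalerBr scalerA divff ?gt_eqF// scale1r opprD addrA.
by rewrite enormZ ger0_norm ?(ltW rk)// exprSr ler_wpM2l ?(ltW rk).
Qed.

(** The points with coordinates [a_i / (m n)], [0 <= a_i < m], lie in the unit
    ball, and a ball of radius less than [1 / (2 m n)] contains at most one of
    them. *)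
Lemma grid_le_covering (m : nat) (rho : R) cs : (0 < m)%N -> (0 < n)%N ->
  rho * (2 * m%:R * n%:R) < 1 -> covers_unit_ball rho cs ->
  (m ^ n <= size cs)%N.
Proof.
move=> m0 n0 rho1 cov.
have mn0 : 0 < m%:R * n%:R :> R by rewrite mulr_gt0 ?ltr0n.
pose g (a : {ffun 'I_n -> 'I_m}) : 'rV[R]_n := \row_j ((a j)%:R / (m%:R * n%:R)).
have g1 a : enorm (g a) <= 1.
  rewrite -(@ler_pXn2r _ 2) ?nnegrE ?enorm_ge0// sqr_enorm expr1n.
  have h j : g a 0 j * g a 0 j <= n%:R^-1.
    have h0 : 0 <= g a 0 j by rewrite mxE divr_ge0 ?ler0n ?(ltW mn0).
    have h1 : g a 0 j <= n%:R^-1.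
      rewrite mxE ler_pdivrMr// mulrCA mulVf ?mulr1 ?pnatr_eq0 -?lt0n//.
      by rewrite ler_nat ltnW.
    apply: le_trans (ler_wpM2l h0 h1) _; rewrite ler_piMl ?invr_ge0 ?ler0n//.
    by apply: (le_trans h1); rewrite invf_le1 ?ltr0n// ler1n.
  apply: le_trans (ler_sum _ (fun j _ => h j)) _.
  by rewrite sumr_const card_ord -(mulr_natr n%:R^-1) mulVf ?pnatr_eq0 -?lt0n.
have [F Fin Fd] : exists2 F : {ffun 'I_n -> 'I_m} -> 'rV[R]_n,
    (forall a, F a \in cs) & (forall a, enorm (g a - F a) <= rho).
  have /choice[F hF] : forall a, exists c, c \in cs /\ enorm (g a - c) <= rho.
    by move=> a; have [c] := cov _ (g1 a); exists c.
  by exists F => a; have [] := hF a.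
have Finj : injective F.
  move=> a b Fab; apply/ffunP => j; apply/val_inj/eqP; apply: contraTT rho1 => abj.
  rewrite -leNgt.
  have d1 : `|g a 0 j - g b 0 j| <= 2 * rho.
    have -> : g a 0 j - g b 0 j = (g a - g b) 0 j by rewrite !mxE.
    apply: le_trans (le_coord_enorm _ _) _.
    have -> : g a - g b = (g a - F a) + - (g b - F b).
      by rewrite Fab opprB addrA subrK.
    by have := enormD (g a - F a) (- (g b - F b)); rewrite enormN;
       have := Fd a; have := Fd b; lra.
  have d2 : 1 <= `|g a 0 j - g b 0 j| * (m%:R * n%:R).
    rewrite -[X in _ * X](gtr0_norm mn0) -normrM mulrBl !mxE !divfK ?gt_eqF//.
    have dist_ge1 (k l : nat) : (k < l)%N -> 1 <= `|k%:R - l%:R| :> R.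
      by move=> kl; rewrite distrC -natrB ?(ltnW kl)// normr_nat ler1n subn_gt0.
    have [/dist_ge1//|/dist_ge1|/val_inj e] := ltngtP (a j) (b j).
      by rewrite distrC.
    by rewrite e eqxx in abj.
  apply: (le_trans d2); rewrite (_ : rho * _ = (2 * rho) * (m%:R * n%:R)).
    by rewrite ler_wpM2r ?(ltW mn0).
  by ring.
have /uniq_leq_size : uniq [seq F a | a <- enum {ffun 'I_n -> 'I_m}].
  by rewrite map_inj_uniq// enum_uniq.
move=> /(_ cs); rewrite size_map -cardE card_ffun !card_ord; apply.
by move=> _ /mapP[a _ ->].
Qed.

Lemma exists_expr_lt (x e : R) : 0 <= x -> x < 1 -> 0 < e ->
  exists k : nat, forall j, (k <= j)%N -> x ^+ j < e.
Proof.
move=> x0 x1 e0.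
have : `|x| < 1 by rewrite ger0_norm.
move=> /cvg_expr /cvgrPdist_lt /(_ e e0)[k _ kP]; exists k => j kj.
by have := kP j kj; rewrite sub0r normrN ger0_norm// exprn_ge0.
Qed.

(** If [N] balls of radius [r] covered the unit ball, then [N ^ k] balls of
    radius [r ^ k] would, for every [k]; as a covering by balls of radius [rho]
    takes at least a constant times [rho ^- n] of them, [(N * r ^ n) ^ k] would
    be bounded below.  The iteration removes the constant, so no volume has to
    be computed. *)
Lemma exists_uncovered_point (r : R) cs : (0 < n)%N -> 0 < r ->
  (size cs)%:R * r ^+ n < 1 ->
  exists2 p, enorm p <= 1 & forall c, c \in cs -> r < enorm (p - c).
Proof.
move=> n0 r0 small; apply: contrapT => nex.
have cov : covers_unit_ball r cs.
  move=> p p1; apply: contrapT => nc; apply: nex; exists p => // c cin.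
  by rewrite ltNge; apply/negP => h; apply: nc; exists c.
have cs0 : (0 < size cs)%N.
  by have [|c] := cov 0; [rewrite enorm0|case: (cs)].
have r1 : r < 1.
  rewrite ltNge; apply: contraTN small => r1; rewrite -leNgt.
  by rewrite -[leLHS]mulr1 ler_pM ?ler1n ?exprn_ege1.
have N0 : (0 : R) < 4 * n%:R by rewrite mulr_gt0 ?ltr0n.
have [k1 hk1] : exists k, forall j, (k <= j)%N -> r ^+ j < (4 * n%:R)^-1.
  by apply: exists_expr_lt; rewrite ?invr_gt0// ltW.
have [k2 hk2] : exists k, forall j, (k <= j)%N ->
    ((size cs)%:R * r ^+ n) ^+ j < (4 * n%:R)^-1 ^+ n.
  apply: exists_expr_lt => //; first by rewrite mulr_ge0 ?exprn_ge0 ?(ltW r0).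
  by rewrite exprn_gt0 ?invr_gt0.
pose k := maxn k1 k2.
have {}hk1 := hk1 k (leq_maxl _ _); have {}hk2 := hk2 k (leq_maxr _ _).
have [cs' szs cov'] := covers_unit_ball_exp r cs k r0 cov.
have rk0 : 0 < r ^+ k by rewrite exprn_gt0.
pose X : R := (4 * n%:R * r ^+ k)^-1.
have X0 : 0 < X by rewrite invr_gt0 mulr_gt0.
pose m := (Num.trunc X).+1.
have Xm : X < m%:R := truncnS_gt X.
have mX : m%:R <= X + 1.
  by rewrite /m -natr1 lerD2r; have /andP[] := truncn_itv (ltW X0).
have XE : X * (4 * n%:R * r ^+ k) = 1 by rewrite mulVf// gt_eqF// mulr_gt0.
have hk1' : r ^+ k * (4 * n%:R) < 1 by rewrite -ltr_pdivlMr// mul1r.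
have /grid_le_covering-/(_ cs' isT n0) : r ^+ k * (2 * m%:R * n%:R) < 1.
  have : m%:R * (4 * n%:R * r ^+ k) <= (X + 1) * (4 * n%:R * r ^+ k).
    by rewrite ler_wpM2r// mulr_ge0 ?ltW.
  by rewrite [(X + 1) * _]mulrDl XE; lra.
move=> /(_ cov'); rewrite szs -(ler_nat R) !natrX => le_mN.
suff : (4 * n%:R)^-1 ^+ n <= ((size cs)%:R * r ^+ n) ^+ k by rewrite leNgt hk2.
have -> : (4 * n%:R)^-1 = X * r ^+ k.
  by rewrite /X (invfM (4 * n%:R)) -mulrA mulVf ?mulr1 ?gt_eqF.
rewrite !exprMn exprAC ler_wpM2r ?exprn_ge0 ?(ltW r0)//.
by apply: le_trans le_mN; rewrite ler_pXn2r ?nnegrE ?ler0n ?(ltW X0)// ltW.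
Qed.

End Covering.

(** * Steep functions are not Goldstein stationary *)

Section Steep.
Context {R : realType} {d : nat}.
Implicit Types (f G H : 'rV[R]_d -> R) (x y q v g : 'rV[R]_d).

(** The Clarke derivative in the direction [v] is an upper limit of difference
    quotients, so a bound on them near [y] bounds it. *)
Lemma clarke_subdiff_steep f y v g (e rho tau : R) :
  0 < rho -> 0 < tau ->
  (forall y' t, eball rho y y' -> 0 < t -> t < tau ->
    f (y' + t *: v) <= f y' - e * t) ->
  clarke_subdiff f y g -> dotv g v <= - e.
Proof.
move=> rho0 tau0 steep /(_ v) gv; rewrite -lee_fin; apply: le_trans gv _.
apply: (@le_trans _ _ (ereal_sup [set ((f (yt.1 + yt.2 *: v) - f yt.1) / yt.2)%:E |
    yt in eball rho y `*` [set t | 0 < t < tau]])).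
  apply: ereal_inf_lbound; exists (eball rho y `*` [set t | 0 < t < tau]) => //.
  exists (eball rho y, [set t | 0 < t < tau]) => //=; split.
    by apply: (near_eball _ _ _ rho0) => z.
  by near=> t; apply/andP; split; near: t; [exact: nbhs_right_gt|exact: nbhs_right_lt].
apply: ub_ereal_sup => _ [[y' t] /= [yy' /andP[t0 tt]] <-].
by rewrite lee_fin ler_pdivrMr//; have := steep _ _ yy' t0 tt; lra.
Unshelve. all: by end_near. Qed.

(** A half-space is convex, so a bound on one directional component survives the
    passage to the convex hull, which bounds on the norm would not. *)
Lemma dist0_goldstein_ge f q v (delta e : R) : enorm v = 1 ->
  (forall y g, eball delta q y -> clarke_subdiff f y g -> dotv g v <= - e) ->
  (e%:E <= dist0 (goldstein_subdiff delta f q))%E.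
Proof.
move=> v1 steep; apply/ereal_infP => _ [g gS <-]; rewrite lee_fin.
have : dotv g v <= - e.
  apply: (gS [set g | dotv g v <= - e]); split; last by move=> h [y qy /steep]; exact.
  move=> x y l; rewrite !inE /= => xe ye.
  rewrite [conv _ _ _](_ : _ = l%:num *: x + (1 - l%:num) *: y)// !dotvE.
  have l0 : 0 <= l%:num by []. have l1 : l%:num <= 1 by [].
  nra.
have := dotv_le_enorm g v; rewrite v1 mulr1 ler_norml => /andP[]; lra.
Qed.

(** The difference form of the bound [<g, v> <= - e] on subgradients: it needs no
    differentiability and passes directly to maxima and minima. *)
Definition steep (v : 'rV[R]_d) (e : R) G : Prop :=
  forall x s, 0 <= s -> G (x + s *: v) <= G x - e * s.

Lemma lipschitz_max K G H : lipschitz_within K setT G ->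
  lipschitz_within K setT H ->
  lipschitz_within K setT (fun x => Num.max (G x) (H x)).
Proof.
move=> lG lH x y _ _; move: (lG x y I I) (lH x y I I); rewrite !ler_norml.
by case: (leP (G x) (H x)); case: (leP (G y) (H y)); lra.
Qed.

Lemma steep_max v e G H : steep v e G -> steep v e H ->
  steep v e (fun x => Num.max (G x) (H x)).
Proof.
move=> sG sH x s s0; move: (sG x s s0) (sH x s s0).
by case: (leP (G x) (H x)); case: (leP (G (x + _)) (H (x + _))); lra.
Qed.

Lemma lipschitz_near_gt (L : R) G x c : 0 < L -> lipschitz_within L setT G ->
  c < G x -> exists2 r, 0 < r & forall y, eball r x y -> c < G y.
Proof.
move=> L0 lG cx; exists ((G x - c) / (2 * L)) => [|y].
  by rewrite divr_gt0 ?mulr_gt0 ?subr_gt0.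
rewrite /eball /= ler_pdivlMr ?mulr_gt0// => xy.
move: (lG y x I I); rewrite ler_norml; nra.
Qed.

Definition truncate (Delta : R) G x : R := Num.max (- Delta) (G x).

(** Truncating a steep function far below its value at [q] does not create
    stationarity near [q]: on the ball of radius [delta] the truncation is not
    active, because the function decreases by at most [L * delta] there. *)
Lemma dist0_goldstein_truncation G q v (L Delta delta e : R) :
  0 < L -> 0 < e -> enorm v = 1 -> L * delta < Delta -> 0 <= G q ->
  lipschitz_within L setT G -> steep v e G ->
  (e%:E <= dist0 (goldstein_subdiff delta (truncate Delta G) q))%E.
Proof.
move=> L0 e0 v1 Ld Gq lG sG; apply: (dist0_goldstein_ge _ _ v) => // y g qy.
have Gy : - Delta < G y.
  move: (lG y q I I) qy; rewrite ler_norml /eball /=; nra.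
pose m := (G y - Delta) / 2.
have [|r r0 Gr] := lipschitz_near_gt _ _ y m L0 lG; first by rewrite /m; lra.
apply: (clarke_subdiff_steep _ _ v _ _ r ((m + Delta) / e)) => //.
  by rewrite divr_gt0//; rewrite /m; lra.
move=> y' t /Gr yr t0; rewrite ltr_pdivlMr// => tt.
have := sG y' t (ltW t0).
rewrite /truncate (_ : Num.max (- Delta) (G y') = G y'); last by apply/max_idPr; rewrite /m in yr; lra.
by case: (leP (- Delta) (G (y' + t *: v))); rewrite /m in yr tt *; lra.
Qed.

Section Truncation.
Variables (G : 'rV[R]_d -> R) (v x0 : 'rV[R]_d) (L Delta e : R).
Hypotheses (L0 : 0 < L) (D0 : 0 < Delta) (e0 : 0 < e).
Hypotheses (lG : lipschitz_within L setT G) (sG : steep v e G) (G0 : G x0 = 0).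
Let f := truncate Delta G.

Lemma steep_unbounded_below : exists x, G x < - Delta.
Proof.
exists (x0 + (2 * Delta / e) *: v).
have s0 : 0 <= 2 * Delta / e by rewrite divr_ge0 ?mulr_ge0// ltW.
have := sG x0 _ s0; rewrite G0 (mulrC e) divfK ?gt_eqF// => h.
by apply: le_lt_trans h _; rewrite sub0r ltrN2 ltr_pMl ?ltr1n.
Qed.

Lemma inf_truncation : inf (range f) = - Delta.
Proof.
have [x Gx] := steep_unbounded_below.
have fx : f x = - Delta by apply/max_idPl/ltW.
apply/eqP; rewrite eq_le; apply/andP; split.
  rewrite -fx; apply: ge_inf; last by exists x.
  by exists (- Delta) => _ [y _ <-]; rewrite /f /truncate le_max lexx.
apply: lb_le_inf; first by exists (f x), x.
by move=> _ [y _ <-]; rewrite /f /truncate le_max lexx.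
Qed.

Lemma truncation_lipschitz_class : lipschitz_class L Delta x0 f.
Proof.
split; last by rewrite inf_truncation /f /truncate G0 opprK (max_idPr _) ?add0r// oppr_le0 ltW.
- apply: lipschitz_max => // x y _ _.
  by rewrite subrr normr0 mulr_ge0 ?enorm_ge0 ?(ltW L0).
- by exists (- Delta) => _ [y _ <-]; rewrite /f /truncate le_max lexx.
Qed.

Lemma interior_argmin_truncation : interior (argmin f) !=set0.
Proof.
have [x Gx] := steep_unbounded_below; exists x.
have lN : lipschitz_within L setT (fun y => - G y).
  by move=> y z _ _; rewrite -opprD normrN; exact: lG.
have [|r r0 rP] := lipschitz_near_gt _ _ x Delta L0 lN; first by lra.
apply: (near_eball _ _ _ r0) => y /rP yr z.
by rewrite {1}/f {1}/truncate (max_idPl _) ?le_max ?lexx//; lra.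
Qed.

End Truncation.

Section LowerEnvelope.
Variables (F : 'rV[R]_d -> 'rV[R]_d -> R) (q0 : 'rV[R]_d) (qs : seq 'rV[R]_d).

(** [q0] is kept apart from [qs] so that the family is nonempty. *)
Definition lower_envelope x := foldr (fun q m => Num.min (F q x) m) (F q0 x) qs.

Lemma lower_envelope_le x q : q \in q0 :: qs -> lower_envelope x <= F q x.
Proof.
rewrite /lower_envelope; elim: qs => [|p ps IH] /=.
  by rewrite inE => /eqP ->.
rewrite !inE orbCA => /orP[/eqP ->|qin]; first by rewrite ge_min lexx.
by rewrite ge_min IH ?orbT// inE.
Qed.

Lemma lower_envelope_attained x :
  exists2 q, q \in q0 :: qs & lower_envelope x = F q x.
Proof.
rewrite /lower_envelope; elim: qs => [|p ps [q qin IH]] /=.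
  by exists q0; rewrite ?mem_head.
rewrite IH; case: (leP (F p x) (F q x)) => _.
  by exists p; rewrite // !inE eqxx orbT.
by exists q => //; move: qin; rewrite !inE orbCA => ->; rewrite orbT.
Qed.

Lemma lipschitz_lower_envelope K : (forall q, lipschitz_within K setT (F q)) ->
  lipschitz_within K setT lower_envelope.
Proof.
move=> lF x y _ _.
have h (a b : 'rV[R]_d) : lower_envelope a - lower_envelope b <= K * enorm (a - b).
  have [q qin ->] := lower_envelope_attained b.
  have := lower_envelope_le a _ qin; have := lF q a b I I.
  by rewrite ler_norml => /andP[]; lra.
by rewrite ler_norml; have := h x y; have := h y x; rewrite enormB; lra.
Qed.

Lemma steep_lower_envelope v e : (forall q, steep v e (F q)) ->
  steep v e lower_envelope.
Proof.
move=> sF x s s0; have [q qin ->] := lower_envelope_attained x.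
exact: le_trans (lower_envelope_le _ _ qin) (sF q x s s0).
Qed.

(** The value at [q] is attained by [F q] alone, and strictly, so by continuity
    [F q] is the least member of the family in a neighbourhood of [q]. *)
Lemma lower_envelope_near (L : R) q : 0 < L ->
  (forall p, lipschitz_within L setT (F p)) -> q \in q0 :: qs ->
  F q q = 0 -> (forall p, p \in q0 :: qs -> p != q -> 0 < F p q) ->
  exists2 r, 0 < r & forall x, eball r q x -> lower_envelope x = F q x.
Proof.
move=> L0 lF qin Fq0 Fpq.
have [r r0 rP] : exists2 r, 0 < r &
    forall p x, p \in q0 :: qs -> eball r q x -> F q x <= F p x.
  elim: (q0 :: qs) Fpq => [|p ps IH] Fpq; first by exists 1.
  have [|r r0 rP] := IH; first by move=> p' p'in; apply: Fpq; rewrite inE p'in orbT.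
  have [->|pq] := eqVneq p q.
    exists r => // p' x; rewrite inE => /orP[/eqP -> //|]; exact: rP.
  have Fp := Fpq p (mem_head _ _) pq.
  exists (Num.min r (F p q / (2 * L))).
    by rewrite lt_min r0 divr_gt0 ?mulr_gt0.
  move=> p' x; rewrite inE /eball /= le_min => /orP[/eqP -> |p'in] /andP[xr xF].
    move: xF (lF p x q I I) (lF q x q I I).
    rewrite ler_pdivlMr ?mulr_gt0// !ler_norml Fq0; nra.
  exact: rP.
exists r => // x xr; apply: le_anti; rewrite lower_envelope_le//=.
by have [p pin ->] := lower_envelope_attained x; exact: rP.
Qed.

End LowerEnvelope.
End Steep.

(** * The gauge of a narrow cone *)

Section Cone.
Context {R : realType} {d : nat}.
Variables (v : 'rV[R]_d) (c e : R).
Hypotheses (v1 : enorm v = 1) (c0 : 0 < c) (e0 : 0 < e).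
Implicit Types x y z q : 'rV[R]_d.

Definition cone_gauge z : R := c * enorm (z - dotv z v *: v) - e * dotv z v.

Lemma dotvv : dotv v v = 1.
Proof. by rewrite -sqr_enorm v1 expr1n. Qed.

Lemma sqr_enorm_orth z :
  enorm (z - dotv z v *: v) ^+ 2 = enorm z ^+ 2 - dotv z v ^+ 2.
Proof. by rewrite !sqr_enorm !dotvE (dotvC v z) dotvv; ring. Qed.

Lemma lipschitz_cone_gauge : lipschitz_within (c + e) setT cone_gauge.
Proof.
move=> x y _ _.
have hD : `|dotv x v - dotv y v| <= enorm (x - y).
  have -> : dotv x v - dotv y v = dotv (x - y) v by rewrite !dotvE.
  by have := dotv_le_enorm (x - y) v; rewrite v1 mulr1.
have hP : `|enorm (x - dotv x v *: v) - enorm (y - dotv y v *: v)| <= enorm (x - y).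
  apply: le_trans (enorm_lip _ _) _.
  rewrite (_ : _ - (_ - _) = (x - y) - dotv (x - y) v *: v); last first.
    by rewrite dotvDl dotvNl; apply/rowP => j; rewrite !mxE; ring.
  rewrite -(@ler_pXn2r _ 2) ?nnegrE ?enorm_ge0// sqr_enorm_orth.
  by rewrite lerBlDr lerDl sqr_ge0.
have -> : cone_gauge x - cone_gauge y =
    c * (enorm (x - dotv x v *: v) - enorm (y - dotv y v *: v)) -
    e * (dotv x v - dotv y v) by rewrite /cone_gauge; ring.
apply: le_trans (ler_normB _ _) _.
by rewrite !normrM (gtr0_norm c0) (gtr0_norm e0) mulrDl lerD// ler_pM2l.
Qed.

Lemma cone_gaugeD z s : cone_gauge (z + s *: v) = cone_gauge z - e * s.
Proof.
rewrite /cone_gauge !dotvDl !dotvZl dotvv mulr1 scalerDl opprD addrACA subrr addr0.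
by ring.
Qed.

Lemma cone_gauge0 : cone_gauge 0 = 0.
Proof.
by rewrite /cone_gauge -(scale0r 0) dotvZl mul0r !scale0r subr0 enorm0 !mulr0 subr0.
Qed.

(** The cone where the gauge is not positive is as narrow as [e / c], so it
    contains [z] only if [v] is close to the direction of [z]: with [s] the
    cosine of the angle, [c ^ 2 (1 - s ^ 2) <= e ^ 2 s ^ 2] gives
    [2 - 2 s <= (e / c) ^ 2], the left side being the squared distance. *)
Lemma cone_gauge_le0 z : z != 0 -> cone_gauge z <= 0 ->
  enorm (v - (enorm z)^-1 *: z) <= e / c.
Proof.
move=> /enorm_gt0 z0; rewrite /cone_gauge => gz.
pose N := enorm z; pose a := dotv z v; pose s := a / N.
have aE : a = s * N by rewrite /s divfK ?gt_eqF.
have ha : 0 <= a.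
  rewrite -(pmulr_rge0 _ e0); apply: le_trans (_ : c * enorm (z - a *: v) <= _).
    by rewrite mulr_ge0 ?enorm_ge0 ?(ltW c0).
  by rewrite /a; lra.
have s0 : 0 <= s by rewrite divr_ge0 ?enorm_ge0.
have s1 : s <= 1.
  rewrite ler_pdivrMr// mul1r; apply: le_trans (ler_norm _) _.
  by have := dotv_le_enorm z v; rewrite v1 mulr1.
have hs : c ^+ 2 * (1 - s ^+ 2) <= e ^+ 2 * s ^+ 2.
  have h : (c * enorm (z - a *: v)) ^+ 2 <= (e * a) ^+ 2.
    rewrite ler_pXn2r ?nnegrE ?mulr_ge0 ?enorm_ge0 ?(ltW c0) ?(ltW e0)//.
    by rewrite /a; lra.
  have N2 : 0 < N ^+ 2 by rewrite exprn_gt0.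
  rewrite -(ler_pM2r N2); move: h.
  rewrite exprMn sqr_enorm_orth -/a -/N exprMn aE.
  have -> : c ^+ 2 * (1 - s ^+ 2) * N ^+ 2 = c ^+ 2 * (N ^+ 2 - (s * N) ^+ 2) by ring.
  by have -> : e ^+ 2 * s ^+ 2 * N ^+ 2 = e ^+ 2 * (s * N) ^+ 2 by ring.
have s00 : 0 < s.
  rewrite lt_def s0 andbT; apply: contraTneq hs => ->.
  by rewrite expr0n/= mulr0 subr0 mulr1 -ltNge exprn_gt0.
rewrite -(@ler_pXn2r _ 2) ?nnegrE ?enorm_ge0 ?divr_ge0 ?(ltW c0) ?(ltW e0)//.
have -> : enorm (v - N^-1 *: z) ^+ 2 = 2 - 2 * s.
  rewrite sqr_enorm !dotvE (dotvC v z) -/a dotvv -sqr_enorm -/N /s.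
  by field; rewrite gt_eqF.
rewrite expr_div_n ler_pdivlMr ?exprn_gt0//.
have s2 : 0 < s ^+ 2 by rewrite exprn_gt0.
rewrite -(ler_pM2r s2); apply: le_trans hs.
rewrite -subr_ge0 (_ : _ - _ = c ^+ 2 * ((1 - s) ^+ 2 * (1 + 2 * s))); last by ring.
by rewrite mulr_ge0 ?sqr_ge0// mulr_ge0 ?sqr_ge0//; lra.
Qed.

End Cone.

(** * Bump functions and the choice of the direction *)

Section Bump.
Context {R : realType} {d : nat}.
Variables (v : 'rV[R]_d) (i : 'I_d) (kappa c e eta : R).
Hypotheses (v1 : enorm v = 1) (c0 : 0 < c) (e0 : 0 < e) (eta0 : 0 < eta).
Hypotheses (kappa0 : 0 < kappa) (kappa_le : kappa <= c + e).
Hypothesis (kappa_v : kappa * v 0 i = e).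
Implicit Types x y z q : 'rV[R]_d.

Definition tilt q x : R := - kappa * (x - q) 0 i.

(** Near [q] this is the tilt, which does not depend on the hidden direction;
    further away the cone takes over.  Both decrease at rate [e] along [v]. *)
Definition bump q x : R := Num.max (tilt q x) (cone_gauge v c e (x - q) - eta).

Lemma lipschitz_tilt q : lipschitz_within kappa setT (tilt q).
Proof.
move=> x y _ _; rewrite /tilt (_ : _ - _ = - kappa * (x - y) 0 i).
  by rewrite normrM normrN (gtr0_norm kappa0) ler_pM2l// le_coord_enorm.
by rewrite !mxE; ring.
Qed.

Lemma tilt_center q : tilt q q = 0.
Proof. by rewrite /tilt subrr mxE mulr0. Qed.

Lemma lipschitz_bump q : lipschitz_within (c + e) setT (bump q).
Proof.
apply: lipschitz_max => x y _ _.
  by apply: le_trans (lipschitz_tilt q x y I I) _; rewrite ler_wpM2r ?enorm_ge0.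
rewrite (_ : _ - _ = cone_gauge v c e (x - q) - cone_gauge v c e (y - q)); last by ring.
have -> : x - y = (x - q) - (y - q) by rewrite opprB addrA subrK.
exact: lipschitz_cone_gauge.
Qed.

Lemma steep_bump q : steep v e (bump q).
Proof.
apply: steep_max => x s s0.
  by rewrite /tilt !mxE -kappa_v; lra.
by rewrite (addrAC x) cone_gaugeD//; lra.
Qed.

Lemma bump_near q : exists2 r, 0 < r & forall x, eball r q x -> bump q x = tilt q x.
Proof.
have ce : 0 < 2 * (c + e) by rewrite mulr_gt0// addr_gt0.
exists (eta / (2 * (c + e))); first exact: divr_gt0.
move=> x; rewrite /eball /= ler_pdivlMr// => xr; apply/max_idPl.
have := lipschitz_tilt q x q I I; have := lipschitz_cone_gauge v c e v1 c0 e0 (x - q) 0 I I.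
have := ler_wpM2r (enorm_ge0 (x - q)) kappa_le.
rewrite cone_gauge0 tilt_center !subr0 !ler_norml; lra.
Qed.

Lemma bump_center q : bump q q = 0.
Proof.
have [r r0 ->] := bump_near q; first exact: tilt_center.
by rewrite /eball /= subrr enorm0 ltW.
Qed.

End Bump.

Lemma exists_margin {R : realType} {T : eqType} (g : T -> R) (zs : seq T) :
  (forall z, z \in zs -> 0 < g z) ->
  exists2 m, 0 < m & forall z, z \in zs -> m < g z.
Proof.
elim: zs => [|a zs IH] pos; first by exists 1.
have [|m m0 mP] := IH; first by move=> z zin; apply: pos; rewrite inE zin orbT.
have a0 := pos a (mem_head _ _).
exists (Num.min m (g a / 2)); first by rewrite lt_min m0 divr_gt0.
move=> z; rewrite inE gt_min => /orP[/eqP ->|/mP ->//].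
by apply/orP; right; lra.
Qed.

Section HiddenDirection.
Context {R : realType}.

Lemma dotv_row_mx (m n : nat) (x1 y1 : 'rV[R]_m) (x2 y2 : 'rV[R]_n) :
  dotv (row_mx x1 x2) (row_mx y1 y2) = dotv x1 y1 + dotv x2 y2.
Proof.
by rewrite /dotv big_split_ord; congr (_ + _); apply: eq_bigr => i _;
   rewrite ?row_mxEl ?row_mxEr.
Qed.

Lemma dotv_scalar (a b : R) : dotv (a%:M : 'rV_1) b%:M = a * b.
Proof. by rewrite /dotv big_ord1 !mxE. Qed.

Lemma enorm_rsubmx_le (m n : nat) (x : 'rV[R]_(m + n)) : enorm (rsubmx x) <= enorm x.
Proof.
rewrite -(@ler_pXn2r _ 2) ?nnegrE ?enorm_ge0// !sqr_enorm -{3 4}(hsubmxK x).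
by rewrite dotv_row_mx lerDr dotv_ge0.
Qed.

(** The unit vectors considered are those with first coordinate [3 / 5] whose
    last [n] coordinates form [(4 / 5) p] with [p] in the unit ball.  For each
    [z], the directions [v] whose cone contains [z] lie in a ball of radius
    [e / c], so the corresponding [p] lie in a ball of radius [(5 / 4) (e / c)]
    of dimension [n]. *)
Lemma exists_hidden_direction (n : nat) (c e : R) (zs : seq 'rV[R]_(1 + (1 + n))) :
  (0 < n)%N -> 0 < c -> 0 < e ->
  (size zs)%:R * (5 / 4 * (e / c)) ^+ n < 1 ->
  exists v : 'rV[R]_(1 + (1 + n)),
    [/\ enorm v = 1, v 0 0 = 3 / 5 &
        forall z, z \in zs -> z != 0 -> 0 < cone_gauge v c e z].
Proof.
move=> n0 c0 e0 small.
pose tail (z : 'rV[R]_(1 + (1 + n))) : 'rV[R]_n := rsubmx (rsubmx z : 'rV_(1 + n)).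
pose center z := (5 / 4) *: tail ((enorm z)^-1 *: z).
have ec0 : 0 < 5 / 4 * (e / c) by rewrite mulr_gt0 ?divr_gt0.
have [|p p1 pP] := exists_uncovered_point (5 / 4 * (e / c)) (map center zs) n0 ec0.
  by rewrite size_map.
pose h := Num.sqrt (1 - enorm p ^+ 2).
have h2 : h * h = 1 - enorm p ^+ 2.
  by rewrite -expr2 sqr_sqrtr// subr_ge0 expr_le1// enorm_ge0.
pose v : 'rV[R]_(1 + (1 + n)) :=
  row_mx (3 / 5)%:M (row_mx (4 / 5 * h)%:M ((4 / 5) *: p)).
have v1 : enorm v = 1.
  apply/eqP; rewrite -(@eqrXn2 _ 2) ?enorm_ge0// sqr_enorm expr1n.
  rewrite !dotv_row_mx !dotv_scalar dotvZl dotvZr -sqr_enorm.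
  by apply/eqP; move: h2; nra.
exists v; split => //.
  have -> : v 0 0 = v 0 (lshift (1 + n) 0) by congr (v 0 _); apply: val_inj.
  by rewrite /v row_mxEl mxE.
move=> z zin zn0; rewrite ltNge; apply/negP => /(cone_gauge_le0 _ _ _ v1 c0 e0 _ zn0) vz.
have := pP _ (map_f center zin); apply/negP; rewrite -leNgt.
have -> : p - center z = (5 / 4) *: tail (v - (enorm z)^-1 *: z).
  rewrite /center (_ : tail (v - _) = (4 / 5) *: p - tail ((enorm z)^-1 *: z)).
    by rewrite scalerBr scalerA (_ : 5 / 4 * (4 / 5) = 1 :> R) ?scale1r//; lra.
  by rewrite /tail !linearB /= /v !row_mxKr.
rewrite enormZ ger0_norm// ler_pM2l//.
by apply: le_trans vz; apply: le_trans (enorm_rsubmx_le _ _ _); exact: enorm_rsubmx_le.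
Qed.

End HiddenDirection.

(** * Runs of an algorithm and the resisting function *)

Section Runs.
Context {R : realType} {d : nat}.
Implicit Types (s : strategy R d) (O : oracle R d) (q : 'rV[R]_d) (h : history R d).

Lemma lipschitz_locally (K : R) (f : 'rV[R]_d -> R) :
  lipschitz_within K setT f -> locally_lipschitz f.
Proof. by move=> lf x; exists 1, K; split => [|y z _ _]; [exact: ltr01|exact: (lf y z I I)]. Qed.

Lemma same_local_info_rcons h h' q (r r' : response R d) :
  same_local_info h h' -> (\forall y \near q, r y = r' y) ->
  same_local_info (rcons h (q, r)) (rcons h' (q, r')).
Proof.
elim: h h' => [|a h IH] [|a' h'] //=.
move=> [aa' near_a hh'] rr'; split => //; exact: IH.
Qed.

(** Only the germs at the points queried under the second oracle matter: they
    determine which point comes next, so the two runs never part. *)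
Lemma transcript_same_local_info s O O' (N : nat) :
  (forall h h', same_local_info h h' -> s h = s h') ->
  (forall k q, (k < N)%N -> queries s O' k q -> \forall y \near q, O k q y = O' k q y) ->
  forall n h, (n <= N)%N -> transcript s O n = Some h ->
  exists2 h', transcript s O' n = Some h' & same_local_info h h'.
Proof.
move=> loc germ; elim=> [|n IH] h nN /=; first by move=> [<-]; exists [::].
case E: (transcript s O n) => [g|]//.
have [g' g'E gg'] := IH g (ltnW nN) E; rewrite g'E -(loc _ _ gg').
case sg: (s g) => [q| |]// [<-]; exists (rcons g' (q, O' n q)) => //.
apply: same_local_info_rcons => //; apply: germ => //.
by exists g' => //; rewrite -(loc _ _ gg').
Qed.

(** The output counts as visited: it must be nonstationary too, although no
    germ is prescribed there by the run. *)
Definition visited_at s O n : option 'rV[R]_d :=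
  if transcript s O n is Some h then
    match s h with Query q | Return q => Some q | Diverge => None end
  else None.

Definition visited s O (N : nat) := pmap (visited_at s O) (iota 0 N.+1).

Lemma size_visited s O N : (size (visited s O N) <= N.+1)%N.
Proof. by rewrite size_pmap (leq_trans (count_size _ _)) ?size_iota. Qed.

Lemma mem_visited s O N n q : (n <= N)%N -> visited_at s O n = Some q ->
  q \in visited s O N.
Proof.
by move=> nN E; rewrite mem_pmap; apply/mapP; exists n; rewrite ?mem_iota ?ltnS.
Qed.

Lemma queries_visited s O N n q : (n <= N)%N -> queries s O n q ->
  q \in visited s O N.
Proof. by move=> nN [h hE sh]; apply: mem_visited nN _; rewrite /visited_at hE sh. Qed.

Lemma returns_visited s O N n q : (n <= N)%N -> returns s O n q ->
  q \in visited s O N.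
Proof. by move=> nN [h hE sh]; apply: mem_visited nN _; rewrite /visited_at hE sh. Qed.

Lemma query_count_gt s O (f : 'rV[R]_d -> R) (delta eps : R) (N : nat) :
  (forall n q, (n <= N)%N -> returns s O n q -> ~ goldstein_stationary delta eps f q) ->
  ((N%:R : R)%:E < query_count s O f delta eps)%E.
Proof.
move=> nstat; apply: (@lt_le_trans _ _ (N.+1%:R : R)%:E).
  by rewrite lte_fin ltr_nat.
apply/ereal_infP => _ [n [q ret stat] <-]; rewrite lee_fin ler_nat ltnNge.
by apply/negP => nN; exact: (nstat n q).
Qed.

End Runs.

Section Resisting.
Context {R : realType} {d : nat}.
Variables (v x0 : 'rV[R]_d) (i : 'I_d) (L Delta delta kappa e eta : R).
Variable (pts : seq 'rV[R]_d).
Hypotheses (v1 : enorm v = 1) (e0 : 0 < e) (eL : e < L) (Delta0 : 0 < Delta).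
Hypotheses (Ldelta : L * delta < Delta) (eta0 : 0 < eta).
Hypotheses (kappa0 : 0 < kappa) (kappaL : kappa <= L) (kappa_v : kappa * v 0 i = e).
Hypothesis (x0pts : x0 \in pts).
Hypothesis gap : forall p q, p \in pts -> q \in pts -> p != q ->
  eta < cone_gauge v (L - e) e (p - q).

Let c := L - e.
Let G := lower_envelope (bump v i kappa c e eta) x0 pts.

Definition resisting_function := truncate Delta G.

Let c0 : 0 < c. Proof. by rewrite subr_gt0. Qed.
Let L0 : 0 < L. Proof. exact: lt_trans eL. Qed.
Let ceL : c + e = L. Proof. by rewrite subrK. Qed.

Let lip_bump q : lipschitz_within L setT (bump v i kappa c e eta q).
Proof. by rewrite -ceL; apply: lipschitz_bump => //; rewrite ceL. Qed.

Let lipG : lipschitz_within L setT G.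
Proof. exact: lipschitz_lower_envelope. Qed.

Let steepG : steep v e G.
Proof. by apply: steep_lower_envelope => q; exact: steep_bump. Qed.

Let G_near q : q \in pts ->
  exists2 r, 0 < r & forall x, eball r q x -> G x = tilt i kappa q x.
Proof.
move=> qin.
have mem p : p \in x0 :: pts -> p \in pts by rewrite inE => /orP[/eqP ->|].
have [|||r r0 rP] := lower_envelope_near (bump v i kappa c e eta) x0 pts L q L0 lip_bump.
- by rewrite inE qin orbT.
- by apply: bump_center => //; rewrite ceL.
- move=> p /mem pin pq; rewrite lt_max subr_gt0 gap ?orbT// eq_sym.
  by [].
have [|r' r'0 r'P] := bump_near v i kappa c e eta v1 c0 e0 eta0 kappa0 _ q.
  by rewrite ceL.
exists (Num.min r r'); first by rewrite lt_min r0.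
by move=> x; rewrite /eball /= le_min => /andP[xr xr']; rewrite /G rP ?r'P.
Qed.

Let G_center q : q \in pts -> G q = 0.
Proof.
move=> /G_near[r r0 ->]; first exact: tilt_center.
by rewrite /eball /= subrr enorm0 ltW.
Qed.

(** Near a point of [pts] the function is the tilt, which involves neither [v]
    nor the other points: this is what the algorithm is shown. *)
Lemma resisting_function_near q : q \in pts ->
  \forall x \near q, resisting_function x = tilt i kappa q x.
Proof.
move=> qin; have [r r0 rP] := G_near q qin.
have [|r' r'0 r'P] := lipschitz_near_gt L G q (- Delta) L0 lipG.
  by rewrite G_center// oppr_lt0.
apply: (near_eball q (Num.min r r')); first by rewrite lt_min r0.
move=> x; rewrite /eball /= le_min => /andP[xr xr'].
by rewrite -rP//; apply/max_idPr/ltW; exact: r'P.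
Qed.

Lemma resisting_function_nonstationary q : q \in pts ->
  (e%:E <= dist0 (goldstein_subdiff delta resisting_function q))%E.
Proof.
by move=> qin; apply: (dist0_goldstein_truncation _ _ v L) => //; rewrite G_center.
Qed.

Lemma resisting_function_class :
  [/\ lipschitz_class L Delta x0 resisting_function, resisting_function x0 = 0,
      inf (range resisting_function) = - Delta
    & interior (argmin resisting_function) !=set0].
Proof.
have Gx0 := G_center _ x0pts; split.
- exact: (truncation_lipschitz_class _ v _ _ _ e).
- by rewrite /resisting_function /truncate Gx0; apply/max_idPr; rewrite oppr_le0 ltW.
- exact: (inf_truncation _ v x0 _ e).
- exact: (interior_argmin_truncation _ v x0 L _ e).
Qed.

End Resisting.

(** The number of pairs of visited points stays below the number of balls needed
    to cover the unit ball; the factor [6 / 5] is the slack that makes the lower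
    bound on the subgradients exceed [eps]. *)
Lemma pairs_times_ball_lt1 {R : realType} (n T : nat) (L eps : R) : (0 < n)%N ->
  0 < eps -> eps < L / 3 ->
  T%:R + 1 <= ((L - eps) / (2 * eps)) `^ (n%:R / 2) ->
  (T.+1 * T.+1)%:R * (5 / 4 * (6 / 5 * eps / (L - 6 / 5 * eps))) ^+ n < 1.
Proof.
move=> n0 eps0 epsL; rewrite natr1 => T_le.
set rho := (5 / 4 * _); set X := (L - eps) / (2 * eps) in T_le.
have X0 : 0 <= X by rewrite divr_ge0; lra.
have T2 : (T.+1 * T.+1)%:R <= X ^+ n.
  apply: (@le_trans _ _ ((X `^ (n%:R / 2)) ^+ 2)).
    by rewrite mulnn natrX ler_pXn2r ?nnegrE ?powR_ge0.
  by rewrite -powR_mulrn ?powR_ge0// -powRrM divfK ?pnatr_eq0// powR_mulrn.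
have c0 : 0 < L - 6 / 5 * eps by lra.
have rho0 : 0 < rho by rewrite mulr_gt0 ?divr_gt0 ?mulr_gt0.
apply: (@le_lt_trans _ _ ((X * rho) ^+ n)).
  by rewrite (exprMn n X rho) ler_wpM2r ?exprn_ge0 ?(ltW rho0).
have Xrho : X * rho = 3 / 4 * (L - eps) / (L - 6 / 5 * eps).
  by rewrite /X /rho; field; rewrite ?gt_eqF//; lra.
have Xrho1 : X * rho < 1 by rewrite Xrho ltr_pdivrMr//; lra.
have Xrho0 : 0 <= X * rho := mulr_ge0 X0 (ltW rho0).
by rewrite exprn_ilt1// -lt0n.
Qed.

(** * The lower bound *)

Theorem theorem2p2 (R : realType) (d : nat) (L Delta : R) (x0 : 'rV[R]_d)
    (delta eps : R) (T : nat) (A : algorithm R)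
    (d_ge3 : (3 <= d)%N) (L_gt0 : 0 < L) (Delta_gt0 : 0 < Delta)
    (delta_gt0 : 0 < delta) (delta_lt : delta < Delta / L)
    (eps_gt0 : 0 < eps) (eps_lt : eps < L / 3)
    (T_ge1 : (1 <= T)%N)
    (T_le : T%:R + 1 <= ((L - eps) / (2 * eps)) `^ ((d%:R - 2) / 2)) :
  let s := A d L Delta x0 delta eps in
  exists f : 'rV[R]_d -> R,
    [/\ lipschitz_class L Delta x0 f,
        (forall O : oracle R d, admissible f O ->
          [/\ ((T%:R : R)%:E < query_count s O f delta eps)%E,
              (forall (k : nat) (q : 'rV[R]_d), (k < T)%N -> queries s O k q ->
                (eps%:E < dist0 (goldstein_subdiff delta f q))%E)
            & (forall (n : nat) (q : 'rV[R]_d), (n <= T)%N -> returns s O n q ->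
                (eps%:E < dist0 (goldstein_subdiff delta f q))%E)]),
        f x0 = 0,
        inf (range f) = - Delta
      & interior (argmin f) !=set0].
Proof.
have [m dE] : exists m, d = m.+3 by exists (d - 3)%N; rewrite -addn3 subnK.
subst d; move=> s.
pose n := m.+1; pose i : 'I_(m.+3) := ord0.
(* [kappa] is determined by [kappa * v_0 = e], where [v_0 = 3 / 5]. *)
pose e : R := 6 / 5 * eps; pose c := L - e; pose kappa := 5 / 3 * e.
have e0 : 0 < e by rewrite mulr_gt0.
have epse : eps < e by rewrite /e; lra.
have eL : e < L by rewrite /e; lra.
have kappa0 : 0 < kappa by rewrite mulr_gt0.
have kappaL : kappa <= L by rewrite /kappa /e; lra.
have Ldelta : L * delta < Delta by rewrite mulrC -ltr_pdivlMr.
(* The run against tilts does not involve [v], so it can be used to choose [v]. *)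
pose O0 (k : nat) (q : 'rV[R]_m.+3) :=
  @Response R _ _ (lipschitz_locally kappa _ (lipschitz_tilt i kappa kappa0 q)).
have s_local h h' : same_local_info h h' -> s h = s h' by exact: algorithm_local.
pose pts := visited s O0 T.
have x0pts : x0 \in pts.
  by apply: (queries_visited _ _ _ 0) => //; exists [::] => //; exact: algorithm_start.
(* Both signs of each difference occur, as the gauge is not symmetric. *)
pose zs := [seq p - q | p <- pts, q <- pts].
have [||||v [v1 v0 zsP]] := exists_hidden_direction n c e zs => //.
- by rewrite subr_gt0.
- apply: le_lt_trans (pairs_times_ball_lt1 n T L eps isT eps_gt0 eps_lt _).
    have rho0 : 0 <= 5 / 4 * (e / c).
      by rewrite mulr_ge0 ?divr_ge0 ?(ltW e0)// subr_ge0 ltW.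
    rewrite -/e -/c; apply: ler_wpM2r; first exact: exprn_ge0.
    by rewrite ler_nat size_allpairs leq_mul// size_visited.
  by have <- : m.+3%:R - 2 = n%:R :> R by rewrite -[m.+3]addn2 natrD addrK.
have kappa_v : kappa * v 0 i = e by rewrite v0 /kappa; field.
have [eta eta0 etaP] : exists2 eta, 0 < eta &
    forall z, z \in [seq z <- zs | z != 0] -> eta < cone_gauge v c e z.
  by apply: exists_margin => z; rewrite mem_filter => /andP[z0 zin]; exact: zsP.
have gap p q : p \in pts -> q \in pts -> p != q -> eta < cone_gauge v c e (p - q).
  move=> pin qin pq; apply: etaP; rewrite mem_filter subr_eq0 pq /=.
  by apply/allpairsP; exists (p, q).
pose f := resisting_function v x0 i L Delta kappa e eta pts.
have far q : q \in pts -> (eps%:E < dist0 (goldstein_subdiff delta f q))%E.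
  move=> qin; apply: (@lt_le_trans _ _ e%:E); first by rewrite lte_fin.
  exact: resisting_function_nonstationary.
have [fclass fx0 finf fint] : [/\ lipschitz_class L Delta x0 f, f x0 = 0,
    inf (range f) = - Delta & interior (argmin f) !=set0].
  exact: resisting_function_class.
exists f; split => // O adm.
have run k h : (k <= T)%N -> transcript s O k = Some h ->
    exists2 h', transcript s O0 k = Some h' & s h = s h'.
  move=> kT hE.
  have [|h' h'E hh'] := transcript_same_local_info s O O0 T s_local _ k h kT hE.
    move=> j q jT qry; have qin := queries_visited _ _ _ _ _ (ltnW jT) qry.
    have [nu nu0 Oq] := adm j q.
    have near_O : \forall y \near q, O j q y = f y by exact: (near_eball q nu).
    have near_f : \forall y \near q, f y = tilt i kappa q y.
      exact: resisting_function_near.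
    by apply: filterS2 near_O near_f => y -> ->.
  by exists h' => //; exact: s_local.
have ret k q : (k <= T)%N -> returns s O k q -> q \in pts.
  move=> kT [h hE sh]; have [h' h'E ss] := run k h kT hE.
  by apply: returns_visited kT _; exists h'; rewrite -?ss.
split.
- apply: query_count_gt => k q kT /(ret _ _ kT) /far; rewrite /goldstein_stationary.
  by rewrite ltNge => /negP.
- move=> k q kT [h hE sh]; apply: far; have [h' h'E ss] := run k h (ltnW kT) hE.
  by apply: queries_visited (ltnW kT) _; exists h'; rewrite -?ss.
- by move=> k q kT /(ret _ _ kT) /far.
Qed.
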